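(* The following identity holds: $$\inf_{x\in\mathcal{X}}\ \sup_{\mathbb{Q}\in\mathcal{W}_{\mathrm G}}\mathbb{E}_{\mathbb{Q}}[\ell(x,\xi)]\;=\;\inf_{x\in\mathcal{X}}\ \sup_{\alpha\in\Delta_{n-1}}\ \sum_{i=1}^n\alpha_i\ \sup_{\mathbb{Q}_i\in\mathcal{W}_i(\varepsilon_i)}\mathbb{E}_{\mathbb{Q}_i}[\ell(x,\xi)].$$
   Context: Let $[n]=\{1,\dots,n\}$, let $\Xi\subseteq\mathbb{R}^m$ and $\mathcal{X}\subseteq\mathbb{R}^d$ be convex and compact, and let $p\in[1,\infty)$. The function $\ell:\mathbb{R}^d\times\Xi\to\mathbb{R}$ is continuous on $\mathcal{X}\times\Xi$. $\mathcal{M}(\Xi)$ is the set of probability distributions supported on $\Xi$ (with finite $p$-th moment), and $W_p$ is the $p$-Wasserstein distance on $\mathcal{M}(\Xi)$ for the Euclidean metric. For each $i\in[n]$, $\widehat{\mathbb{P}}_i=\frac1{N_i}\sum_{k=1}^{N_i}\delta_{\widehat\xi_i^k}$ is the empirical distribution of points $\widehat\xi_i^1,\dots,\widehat\xi_i^{N_i}\in\Xi$, $\varepsilon_i\ge0$, and $\mathcal{W}_i(\varepsilon_i)=\{\mathbb{Q}\in\mathcal{M}(\Xi):W_p(\mathbb{Q},\widehat{\mathbb{P}}_i)\le\varepsilon_i\}$. $\Delta_{n-1}=\{\alpha\in\mathbb{R}^n:\alpha_i\ge0,\ \sum_i\alpha_i=1\}$. The global ambiguity set is $\mathcal{W}_{\mathrm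 G}=\{\sum_{i=1}^n\alpha_i\mathbb{Q}_i:\ \alpha\in\Delta_{n-1},\ \mathbb{Q}_i\in\mathcal{W}_i(\varepsilon_i)\ \forall i\in[n]\}$. *)

(* Defs.v *)
From HB Require Import structures.
From mathcomp Require Import all_boot all_order all_algebra.
From mathcomp Require Import all_classical all_reals all_analysis.
Set Implicit Arguments.
Unset Strict Implicit.
Unset Printing Implicit Defensive.
Import Order.TTheory GRing.Theory Num.Theory.
Import numFieldNormedType.Exports.
Local Open Scope classical_set_scope.
Local Open Scope ring_scope.
Local Open Scope ereal_scope.

(* R^m with its Borel sigma-algebra; the topology of 'rV[R]_m is the usual one
   (its library norm is the sup norm). *)
Definition borelRV (R : realType) (m : nat) :=
  g_sigma_algebraType (@open 'rV[R]_m).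

Definition eucl_norm (R : realType) (m : nat) (v : 'rV[R]_m) : R :=
  Num.sqrt (\sum_(j < m) (v ord0 j) ^+ 2)%R.

Definition eucl_dist (R : realType) (m : nat) (v w : 'rV[R]_m) : R :=
  eucl_norm (v - w)%R.

(* (1/N) * \sum_(k < N) \d_(xi k); N_gt0 only serves to make this measure a
   probability, through the instance below. *)
Definition empirical (R : realType) (m N : nat) (N_gt0 : (0 < N)%N)
    (xi : 'I_N -> borelRV R m) (A : set (borelRV R m)) : \bar R :=
  (N%:R^-1)%:E * \sum_(k < N) \d_(xi k) A.

Section empirical_probability.
Context (R : realType) (m N : nat) (N_gt0 : (0 < N)%N).
Variable xi : 'I_N -> borelRV R m.

Let emp := empirical N_gt0 xi.

Let emp0 : emp set0 = 0.
Proof.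
by rewrite /emp /empirical big1 ?mule0// => k _; rewrite measure0.
Qed.

Let emp_ge0 A : 0 <= emp A.
Proof.
by apply: mule_ge0; [rewrite lee_fin invr_ge0 | apply: sume_ge0].
Qed.

Let emp_sigma_additive : semi_sigma_additive emp.
Proof.
pose m_ (k : nat) : {measure set (borelRV R m) -> \bar R} :=
  if insub k is Some i then dirac (xi i) else mzero.
have Nr0 : (0 <= N%:R^-1 :> R)%R by rewrite invr_ge0.
suff -> : emp = mscale (NngNum Nr0) (msum m_ N).
  exact: measure_semi_sigma_additive.
apply/funext => A; rewrite /emp /empirical /mscale /msum /=; congr (_ * _).
by apply: eq_bigr => k _; rewrite /m_ valK.
Qed.

HB.instance Definition _ := isMeasure.Build _ _ _ (empirical N_gt0 xi)
  emp0 emp_ge0 emp_sigma_additive.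

Let emp_setT : emp setT = 1.
Proof.
rewrite /emp /empirical (eq_bigr (fun=> 1)); last first.
  by move=> k _; rewrite diracT.
rewrite sumEFin sumr_const card_ord -EFinM mulVf//.
by rewrite pnatr_eq0 -lt0n.
Qed.

HB.instance Definition _ := Measure_isProbability.Build _ _ _
  (empirical N_gt0 xi) emp_setT.

End empirical_probability.

Section wasserstein.
Context (R : realType) (m : nat).
Implicit Types (P Q : probability (borelRV R m) R) (Xi : set 'rV[R]_m).

(* Meant for Borel Xi: Q is then supported on Xi iff Q Xi = 1. *)
Definition prob_on Xi (p : R) : set (probability (borelRV R m) R) :=
  [set Q : probability (borelRV R m) R |
    Q Xi = 1 /\ \int[Q]_xi ((eucl_norm xi) `^ p)%:E < +oo].

Definition couplings P Q : set (probability (borelRV R m * borelRV R m)%type R) :=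
  [set pi : probability (borelRV R m * borelRV R m)%type R |
    (forall A, measurable A -> pushforward pi fst A = P A) /\
    (forall B, measurable B -> pushforward pi snd B = Q B)].

Definition wasserstein (p : R) P Q : \bar R :=
  (ereal_inf [set \int[pi]_z ((eucl_dist z.1 z.2) `^ p)%:E
             | pi in couplings P Q]) `^ p^-1.

Definition wasserstein_ball Xi (p : R) P (eps : R) :
    set (probability (borelRV R m) R) :=
  [set Q : probability (borelRV R m) R | prob_on Xi p Q /\ wasserstein p Q P <= eps%:E].

(* l is only meaningful on Xi, and Q is supported on Xi. *)
Definition expected_loss Xi (l : 'rV[R]_m -> R) Q : \bar R :=
  \int[Q]_(xi in Xi) (l xi)%:E.

End wasserstein.

Definition simplex (R : realType) (n : nat) : set ('I_n -> R) :=
  [set a : 'I_n -> R | (forall i, (0 <= a i)%R) /\ (\sum_(i < n) a i = 1)%R].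

Definition mixtures (R : realType) (m n : nat)
    (W : 'I_n -> set (probability (borelRV R m) R)) :
    set (probability (borelRV R m) R) :=
  [set Q : probability (borelRV R m) R | exists a : 'I_n -> R,
    exists Qs : 'I_n -> probability (borelRV R m) R,
    [/\ simplex a, forall i, W i (Qs i) &
      forall A, measurable A -> Q A = \sum_(i < n) (a i)%:E * Qs i A]].

(* Main.v *)
(* The two suprema already agree for each fixed x. Integration against a
   mixture is the mixture of the integrals, which gives one inequality; for the
   other, choose near-optimal Q_i in each ball and mix them. The balls are
   nonempty (each contains its centre) and the loss is bounded on the compact
   set Xi, so all the suprema involved are finite. *)
Require Import Defs.
From HB Require Import structures.
From mathcomp Require Import all_boot all_order all_algebra.
From mathcomp Require Import all_classical all_reals all_analysis.
From mathcomp Require Import measurable_realfun.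
Import Order.TTheory GRing.Theory Num.Theory.
Import numFieldNormedType.Exports.
Local Open Scope classical_set_scope.
Local Open Scope ring_scope.
Local Open Scope ereal_scope.

Set Implicit Arguments.
Unset Strict Implicit.

(** * Finite mixtures of probability measures and integration against them *)

Section mixture_of_measures.
Context d (T : measurableType d) (R : realType) (n : nat).
Implicit Types (a : 'I_n -> R) (Qs : 'I_n -> probability T R).

(* The absolute value only serves to obtain a {nonneg R} from an arbitrary real. *)
Definition weighted_measure a Qs (k : nat) : {measure set T -> \bar R} :=
  if insub k is Some i then mscale (`|a i|%:nng)%R (Qs i) else mzero.

Lemma weighted_measureE a Qs (i : 'I_n) :
  weighted_measure a Qs i = mscale (`|a i|%:nng)%R (Qs i).
Proof. by rewrite /weighted_measure valK. Qed.

Lemma msum_weighted_measure a Qs A : (forall i, (0 <= a i)%R) ->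
  msum (weighted_measure a Qs) n A = \sum_(i < n) (a i)%:E * Qs i A.
Proof.
move=> a0; apply: eq_bigr => i _.
by rewrite weighted_measureE /mscale/= /mscale/= [X in X%:E]ger0_norm.
Qed.

Lemma exists_mixture a Qs : simplex a ->
  exists Q : probability T R,
    forall A, measurable A -> Q A = \sum_(i < n) (a i)%:E * Qs i A.
Proof.
move=> [a0 a1].
have mT : msum (weighted_measure a Qs) n setT = 1.
  rewrite msum_weighted_measure//.
  under eq_bigr do rewrite probability_setT mule1.
  by rewrite sumEFin a1.
pose Q := HB.pack_for (probability T R) (msum (weighted_measure a Qs) n)
  (Measure_isProbability.Build _ _ _ (msum (weighted_measure a Qs) n) mT).
by exists Q => A _; exact: msum_weighted_measure.
Qed.

(** [Q] agrees with the finite sum of scaled measures on measurable sets, which determines the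
    integral; for nonnegative functions the integral is additive and homogeneous in the measure. *)
Lemma ge0_integral_mixture (Q : probability T R) a Qs D (f : T -> \bar R) :
  measurable D -> (forall i, (0 <= a i)%R) ->
  (forall A, measurable A -> Q A = \sum_(i < n) (a i)%:E * Qs i A) ->
  measurable_fun D f -> (forall x, D x -> 0 <= f x) ->
  \int[Q]_(x in D) f x = \sum_(i < n) (a i)%:E * \int[Qs i]_(x in D) f x.
Proof.
move=> mD a0 QE mf f0.
rewrite (eq_measure_integral (msum (weighted_measure a Qs) n)); last first.
  move=> A mA _; apply: (eq_trans (QE _ mA)); exact/esym/msum_weighted_measure.
rewrite ge0_integral_measure_sum//; apply: eq_bigr => i _.
rewrite weighted_measureE ge0_integral_mscale//=.
by rewrite ger0_norm.
Qed.

(** The nonnegative case applies to [f^\+] and [f^\-]; integrability under every component makes all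
    these integrals finite, so their difference is never of the form oo - oo. *)
Lemma integral_mixture (Q : probability T R) a Qs D (f : T -> \bar R) :
  measurable D -> (forall i, (0 <= a i)%R) ->
  (forall A, measurable A -> Q A = \sum_(i < n) (a i)%:E * Qs i A) ->
  (forall i, (Qs i).-integrable D f) -> measurable_fun D f ->
  \int[Q]_(x in D) f x = \sum_(i < n) (a i)%:E * \int[Qs i]_(x in D) f x.
Proof.
move=> mD a0 QE fi mf.
rewrite integralE (ge0_integral_mixture mD a0 QE)//; last exact: measurable_funepos.
rewrite (ge0_integral_mixture mD a0 QE)//; last exact: measurable_funeneg.
(* Real representatives of the integrals, so that the rest is algebra in [R]. *)
pose u i := fine (\int[Qs i]_(x in D) f^\+ x).
pose v i := fine (\int[Qs i]_(x in D) f^\- x).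
have uE i : \int[Qs i]_(x in D) f^\+ x = (u i)%:E.
  by rewrite fineK//; exact: (integrable_pos_fin_num mD (fi i)).
have vE i : \int[Qs i]_(x in D) f^\- x = (v i)%:E.
  by rewrite fineK//; exact: (integrable_neg_fin_num mD (fi i)).
under eq_bigr do rewrite uE.
under [X in _ - X]eq_bigr do rewrite vE.
under [RHS]eq_bigr do rewrite integralE uE vE -EFinB -EFinM.
under eq_bigr do rewrite -EFinM.
under [X in _ - X]eq_bigr do rewrite -EFinM.
rewrite !sumEFin -EFinB -sumrB; congr (_%:E).
by apply: eq_bigr => i _; rewrite mulrBr.
Qed.

End mixture_of_measures.

(** * Borel measurability on row vectors, and the vanishing self-distance of a measure *)

Section borel_rowvec.
Context (R : realType) (m : nat).

Lemma closed_measurable_borelRV (D : set 'rV[R]_m) :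
  closed D -> measurable (D : set (borelRV R m)).
Proof.
move=> cD; rewrite -(setCK D); apply: measurableC.
by apply: sub_sigma_algebra; exact: closed_openC.
Qed.

Lemma within_continuous_measurable_borelRV (D : set 'rV[R]_m)
    (f : 'rV[R]_m -> R) :
  closed D -> {within D, continuous f} ->
  measurable_fun (D : set (borelRV R m)) (f : borelRV R m -> R).
Proof.
move=> cD /continuousP cf.
(* It suffices to treat preimages of bounded open intervals; each is the trace on [D] of an open set
   [V], and [D] is measurable because it is closed. *)
apply: (measurability _ (RGenOpens.measurableE R)).
move=> _ [_ [a [b ->] <-]].
have [V oV VE] := (open_subspaceP _ _).1
  (cf _ (@interval_open _ (BRight a) (BLeft b) isT isT)).
rewrite setIC -VE; apply: measurableI.
  exact: sub_sigma_algebra.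
exact: closed_measurable_borelRV.
Qed.

Lemma measurable_coord_borelRV (j : 'I_m) :
  measurable_fun setT (fun v : borelRV R m => (v : 'rV[R]_m) ord0 j).
Proof.
apply: (@within_continuous_measurable_borelRV setT
  (fun v : 'rV[R]_m => v ord0 j) closedT).
by apply: continuous_subspaceT; exact: coord_continuous.
Qed.

(** The domain is general so as to cover both [borelRV R m] and pairs under the product
    sigma-algebra, where measurability is checked coordinate by coordinate. *)
Lemma measurable_eucl_norm d (T : measurableType d) (f : T -> 'rV[R]_m) :
  (forall j, measurable_fun setT (fun t => f t ord0 j)) ->
  measurable_fun setT (fun t => eucl_norm (f t)).
Proof.
move=> mf; apply: (measurableT_comp
  (continuous_measurable_fun (@sqrt_continuous R))).
by apply: measurable_sum => j; exact: measurable_funX.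
Qed.

Lemma measurable_eucl_distX (p : R) :
  measurable_fun setT (fun z : borelRV R m * borelRV R m =>
    ((eucl_dist z.1 z.2) `^ p)%:E).
Proof.
apply/measurable_EFinP; apply: (measurableT_comp (measurable_powR p)).
apply: measurable_eucl_norm => j.
rewrite (_ : (fun t => _) = (fun t : borelRV R m * borelRV R m =>
   (t.1 : 'rV[R]_m) ord0 j - (t.2 : 'rV[R]_m) ord0 j)%R); last first.
  by apply/funext => t; rewrite !mxE.
apply: measurable_funB.
  exact: (measurableT_comp (measurable_coord_borelRV j) measurable_fst).
exact: (measurableT_comp (measurable_coord_borelRV j) measurable_snd).
Qed.

Lemma eucl_dist_self (v : 'rV[R]_m) : eucl_dist v v = 0%R.
Proof.
by rewrite /eucl_dist /eucl_norm subrr big1 ?sqrtr0// => j _; rewrite mxE expr0n.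
Qed.

(** The image of [P] under the diagonal map [x] to [(x, x)] is a coupling of [P] with itself of zero
    cost. *)
Lemma wasserstein_self (p : R) (P : probability (borelRV R m) R) :
  p != 0%R -> wasserstein p P P = 0.
Proof.
move=> p0; rewrite /wasserstein.
set S := [set _ | _ in _].
suff -> : ereal_inf S = 0 by rewrite poweR0r// invr_eq0.
apply/eqP; rewrite eq_le; apply/andP; split; last first.
  apply: le_ereal_inf_tmp => _ [pi _ <-]; apply: integral_ge0 => z _.
  by rewrite lee_fin powR_ge0.
apply: ereal_inf_lbound.
have mdiag : measurable_fun setT (fun x : borelRV R m => (x, x)).
  exact: measurable_fun_pair.
pose diag := mfun_Sub (mem_set mdiag).
exists (distribution P diag); first by split.
rewrite ge0_integral_distribution//=; last 2 first.
- exact: measurable_eucl_distX.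
- by move=> y; rewrite lee_fin powR_ge0.
rewrite integral0_eq// => x _ /=.
(* Here [p != 0] matters: zero to the power zero is one. *)
by rewrite eucl_dist_self powR0.
Qed.

End borel_rowvec.

(** * Consequences of compactness: bounded losses, integrability, finite moments *)

Section expected_loss_bounds.
Context (R : realType) (m : nat).
Implicit Types (Xi : set 'rV[R]_m) (Q : probability (borelRV R m) R).

Lemma within_continuous_compact_bounded Xi (f : 'rV[R]_m -> R) :
  compact Xi -> {within Xi, continuous f} ->
  exists2 C : R, (0 <= C)%R & forall x, Xi x -> (`|f x| <= C)%R.
Proof.
move=> cXi cf; have /compact_bounded[M [Mreal hM]] := continuous_compact cf cXi.
(* [hM] gives a bound for every constant strictly above [M]; this one is also nonnegative. *)
exists (`|M| + 1)%R => [|x Xx]; first exact: addr_ge0.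
apply: hM; last by exists x.
by rewrite (le_lt_trans (ler_norm M))// ltrDl.
Qed.

Lemma continuous_eucl_norm : continuous (@eucl_norm R m).
Proof.
move=> v; apply: (@continuous_comp _ _ _
  (fun w : 'rV[R]_m => \sum_(j < m) (w ord0 j) ^+ 2)%R Num.sqrt).
  apply: (continuous_big add_continuous) => j _ w.
  exact: (continuousM (@coord_continuous _ _ _ ord0 j w)
                      (@coord_continuous _ _ _ ord0 j w)).
exact: sqrt_continuous.
Qed.

Lemma expected_loss_integrable Xi (f : 'rV[R]_m -> R) Q :
  compact Xi -> {within Xi, continuous f} ->
  Q.-integrable Xi (fun x => (f x)%:E).
Proof.
move=> cXi cf.
have clXi : closed Xi by apply: compact_closed => //; exact: norm_hausdorff.
have mf := within_continuous_measurable_borelRV clXi cf.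
apply: measurable_bounded_integrable => //.
- exact: closed_measurable_borelRV.
- by rewrite (le_lt_trans (probability_le1 _ _)) ?ltry//;
    exact: closed_measurable_borelRV.
have [C C0 fC] := within_continuous_compact_bounded cXi cf.
exists C; split; first exact: num_real.
by move=> M CM x Xx; exact: (le_trans (fC _ Xx) (ltW CM)).
Qed.

(** The bound is uniform in [Q], which is what later keeps the suprema over [Q] finite. *)
Lemma abse_expected_loss_le Xi (f : 'rV[R]_m -> R) (C : R) Q :
  compact Xi -> {within Xi, continuous f} -> (0 <= C)%R ->
  (forall x, Xi x -> (`|f x| <= C)%R) -> `|expected_loss Xi f Q| <= C%:E.
Proof.
move=> cXi cf C0 fC.
have clXi : closed Xi by apply: compact_closed => //; exact: norm_hausdorff.
have mXi := closed_measurable_borelRV clXi.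
have mf : measurable_fun (Xi : set (borelRV R m)) (fun x => (f x)%:E).
  by apply/measurable_EFinP; exact: within_continuous_measurable_borelRV.
apply: (le_trans (le_abse_integral _ mXi mf)).
apply: (le_trans (integral_le_bound C%:E mXi mf _ _)) => //.
  by apply: aeW => x Xx /=; rewrite lee_fin fC.
by rewrite -[leRHS]mule1 lee_pmul// ?lee_fin// probability_le1.
Qed.

(** The complement of [Xi] is [Q]-null and the norm is bounded on [Xi], so the moment condition is
    automatic. *)
Lemma prob_on_compact Xi (p : R) Q :
  compact Xi -> (0 <= p)%R -> Q Xi = 1 -> prob_on Xi p Q.
Proof.
move=> cXi p0 QXi; split=> //.
have clXi : closed Xi by apply: compact_closed => //; exact: norm_hausdorff.
have mXi := closed_measurable_borelRV clXi.
have cn : {within Xi, continuous (@eucl_norm R m)}.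
  exact/continuous_subspaceT/continuous_eucl_norm.
have [C C0 nC] := within_continuous_compact_bounded cXi cn.
have mn : measurable_fun setT (fun x : borelRV R m => (eucl_norm x `^ p)%:E).
  apply/measurable_EFinP; apply: (measurableT_comp (measurable_powR p)).
  by apply: measurable_eucl_norm => j; exact: measurable_coord_borelRV.
have QXiC : Q (~` Xi) = 0 by rewrite probability_setC// QXi subee.
rewrite (@ge0_negligible_integral _ (borelRV R m) _ Q setT
  (~` Xi : set (borelRV R m)))//; last 2 first.
- exact: measurableC.
- by move=> x _; rewrite lee_fin powR_ge0.
rewrite setTD setCK; apply: integrable_lty => //.
apply: measurable_bounded_integrable => //.
- by rewrite (le_lt_trans (probability_le1 _ _)) ?ltry.
- by apply: measurable_funTS; exact/measurable_EFinP.
exists (C `^ p)%R; split; first exact: num_real.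
move=> M CM x Xx /=; rewrite ger0_norm ?powR_ge0// (le_trans _ (ltW CM))//.
apply: ge0_ler_powR => //; rewrite ?nnegrE ?sqrtr_ge0//.
exact: le_trans (ler_norm _) (nC _ Xx).
Qed.
End expected_loss_bounds.

(** * Suprema of the expected loss over mixtures *)

Section mixture_sup.
Context (R : realType) (m n : nat) (Xi : set 'rV[R]_m).

Lemma empirical_in_wasserstein_ball (N : nat) (N_gt0 : (0 < N)%N)
    (xi : 'I_N -> 'rV[R]_m) (p eps : R) :
  compact Xi -> (1 <= p)%R -> (forall k, Xi (xi k)) -> (0 <= eps)%R ->
  wasserstein_ball Xi p (empirical N_gt0 xi) eps (empirical N_gt0 xi).
Proof.
move=> cXi p1 xiX eps0; have p0 : (0 < p)%R by exact: lt_le_trans p1.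
split; last by rewrite wasserstein_self ?gt_eqF// lee_fin.
apply: prob_on_compact => //; first exact: ltW.
rewrite /= /empirical (eq_bigr (fun=> 1)); last first.
  by move=> k _; rewrite diracE mem_set.
by rewrite sumEFin sumr_const card_ord -EFinM mulVf// pnatr_eq0 -lt0n.
Qed.

Lemma ereal_sup_mixtures (f : 'rV[R]_m -> R)
    (W : 'I_n -> set (probability (borelRV R m) R)) :
  compact Xi -> {within Xi, continuous f} -> (forall i, W i !=set0) ->
  ereal_sup [set expected_loss Xi f Q | Q in mixtures W] =
  ereal_sup [set \sum_(i < n) (a i)%:E *
                   ereal_sup [set expected_loss Xi f Qi | Qi in W i]
            | a in @simplex R n].
Proof.
move=> cXi cf W0; pose S i := ereal_sup [set expected_loss Xi f Qi | Qi in W i].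
have clXi : closed Xi by apply: compact_closed => //; exact: norm_hausdorff.
have mXi := closed_measurable_borelRV clXi.
have mf : measurable_fun (Xi : set (borelRV R m)) (fun x => (f x)%:E).
  by apply/measurable_EFinP; exact: within_continuous_measurable_borelRV.
have lossE a (Qs : _ -> probability (borelRV R m) R)
      (Q : probability (borelRV R m) R) : simplex a ->
    (forall A, measurable A -> Q A = \sum_(i < n) (a i)%:E * Qs i A) ->
    expected_loss Xi f Q = \sum_(i < n) (a i)%:E * expected_loss Xi f (Qs i).
  move=> [a0 _] QE; apply: integral_mixture => // i.
  exact: expected_loss_integrable.
have [C C0 fC] := within_continuous_compact_bounded cXi cf.
have loss_le Q := abse_expected_loss_le Q cXi cf C0 fC.
have loss_fin Q : expected_loss Xi f Q \is a fin_num.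
  by rewrite fin_num_abs (le_lt_trans (loss_le Q))// ltry.
(* Any member of [W i] bounds [S i] from below, and [C] bounds it from above; finiteness is what
   provides near-optimal elements. *)
have S_fin i : S i \is a fin_num.
  have [Q WQ] := W0 i; rewrite fin_numElt; apply/andP; split.
    apply: (@lt_le_trans _ _ (expected_loss Xi f Q)).
      by rewrite ltNye_eq loss_fin.
    by apply: ereal_sup_ubound; exists Q.
  rewrite (@le_lt_trans _ _ C%:E)// ?ltry//; apply: ge_ereal_sup => _ [Q' _ <-].
  exact: le_trans (lee_abs _) (loss_le _).
apply/eqP; rewrite eq_le; apply/andP; split.
  (* A mixture is compared with the weighted sum of suprema having the same weights [a]. *)
  apply: ge_ereal_sup => _ [Q [a [Qs [sa WQs QE]]] <-].
  apply: le_ereal_sup_tmp; exists (\sum_(i < n) (a i)%:E * S i); first by exists a.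
  rewrite (lossE a Qs)//; apply: lee_sum => i _; apply: lee_wpmul2l.
    by rewrite lee_fin; case: sa.
  by apply: ereal_sup_ubound; exists (Qs i).
apply: ge_ereal_sup => _ [a sa <-]; apply/lee_addgt0Pr => e e0.
(* The same slack [e] serves every index, since the weights sum to one and the mixture then loses at
   most [e] in total. *)
have /choice[Qs /all_and2[WQs SQs]] i :
    exists Q, W i Q /\ S i <= expected_loss Xi f Q + e%:E.
  have [_ [Q WQ <-] QS] := ub_ereal_sup_adherent e0 (S_fin i).
  by exists Q; split=> //; rewrite -leeBlDr// ltW.
have [Q QE] := exists_mixture Qs sa.
apply: (@le_trans _ _ (expected_loss Xi f Q + e%:E)); last first.
  apply: leeD2r; apply: ereal_sup_ubound; exists Q => //.
  by exists a, Qs.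
rewrite (lossE a Qs)//; case: sa => a0 a1.
apply: (@le_trans _ _
  (\sum_(i < n) (a i)%:E * (expected_loss Xi f (Qs i) + e%:E))).
  by apply: lee_sum => i _; apply: lee_wpmul2l; rewrite ?lee_fin//; exact: SQs.
under eq_bigr do rewrite muleDr ?fin_num_adde_defl//.
by rewrite big_split/= -ge0_sume_distrl ?sumEFin ?a1 ?mul1e// => i _;
  rewrite lee_fin.
Qed.

End mixture_sup.

Unset Implicit Arguments.
Set Strict Implicit.

Theorem lemma4 (R : realType) (d m n : nat)
    (X : set 'rV[R]_d) (Xi : set 'rV[R]_m)
    (X_convex : convex_set X) (X_compact : compact X)
    (Xi_convex : convex_set Xi) (Xi_compact : compact Xi)
    (p : R) (p_ge1 : (1 <= p)%R)
    (l : 'rV[R]_d -> 'rV[R]_m -> R)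
    (l_cont : {within X `*` Xi, continuous (fun z => l z.1 z.2)})
    (N : 'I_n -> nat) (N_gt0 : forall i, (0 < N i)%N)
    (xihat : forall i, 'I_(N i) -> 'rV[R]_m)
    (xihat_in : forall i k, Xi (xihat i k))
    (eps : 'I_n -> R) (eps_ge0 : forall i, (0 <= eps i)%R) :
  let W i := wasserstein_ball Xi p (empirical (N_gt0 i) (xihat i)) (eps i) in
  ereal_inf [set ereal_sup [set expected_loss Xi (l x) Q | Q in mixtures W]
            | x in X] =
  ereal_inf [set ereal_sup
      [set \sum_(i < n) (a i)%:E *
             ereal_sup [set expected_loss Xi (l x) Qi | Qi in W i]
      | a in @simplex R n]
    | x in X].
Proof.
move=> W; congr ereal_inf; apply: eq_imagel => x Xx.
apply: ereal_sup_mixtures => //; last first.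
  by move=> i; exists (empirical (N_gt0 i) (xihat i));
    exact: empirical_in_wasserstein_ball.
(* Continuity of the slice [l x] on [Xi]: compose the joint continuity at [(x, y)] with [pair x]. A
   product neighbourhood [A], [B] of [(x, y)] has [x] in [A], so [B] is the required neighbourhood
   of [y]. *)
apply/subspace_continuousP => y Xiy.
have l_xy := (subspace_continuousP _ _).1 l_cont (x, y) (conj Xx Xiy).
apply: (cvg_comp (pair x) _ _ l_xy) => P wP.
have [[A B] /= [nA nB] AB] := wP.
apply: filterS nB => y' By' Xiy'.
by apply: (AB (x, y')); split=> //=; exact: nbhs_singleton nA.
Qed.
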